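(* Consider a network of $K$ quantum sensors with local Hermitian generators $\hat h_1,\dots,\hat h_K$ ($\hat h_j$ acting on sensor $j$ only) and a pure probe state $\rho=|\psi\rangle\langle\psi|$. Suppose the noise covariance matrix has the form $V_{ij}=g^2 v_{ij}$, where $g$ is an unknown real parameter and $v=(v_{ij})$ is a known real symmetric positive semidefinite $K\times K$ matrix. Then the (weak-noise) quantum Fisher information for estimating $g$ is $$\mathcal F_{\mathcal Q}(g)=4\operatorname{Tr}(v\,\mathcal H),$$ where $\mathcal H_{ij}=\langle\psi|\hat h_i\hat h_j|\psi\rangle-\langle\psi|\hat h_i|\psi\rangle\langle\psi|\hat h_j|\psi\rangle$.
   Context: The network has Hilbert space $\mathscr H^{\otimes K}$, with $\mathscr H$ the (possibly infinite-dimensional) single-sensor Hilbert space; the unit vector $\psi$ lies in the domain of every $\hat h_i$ and $\hat h_i\hat h_j$. The parameter $g$ is encoded by a weak-noise channel with covariance $V=g^2v$, i.e. as $g\to0$, $$\rho_g=\Phi_V(\rho)=\rho+g^2\sum_{i,j=1}^K v_{ij}\left(\hat h_i\rho\hat h_j-\tfrac12\{\hat h_i\hat h_j,\rho\}\right)+R_g,\qquad \|R_g\|_1=o(g^2),$$ where $\{A,B\}=AB+BA$ and $\|\cdot\|_1$ is the trace norm. The weak-noise quantum Fisher information $\mathcal F_{\mathcal Q}(g)$ is the coefficient defined through the Bures distance from the unperturbed state, $$8\left(1-\sqrt{F(\rho,\rho_g)}\right)=\mathcal F_{\mathcal Q}(g)\,g^2+o(g^2)\quad (g\to0),$$ with $F(\tau,\rho)=\left(\operatorname{Tr}\sqrt{\sqrt\tau\,\rho\,\sqrt\tau}\right)^2$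 the fidelity. *)

(* Defs.v *)
From HB Require Import structures.
From mathcomp Require Import all_boot all_order all_algebra.
From mathcomp Require Import all_classical all_reals all_analysis.
From mathcomp Require Import complex ring lra.

Set Implicit Arguments.
Unset Strict Implicit.
Unset Printing Implicit Defensive.

Import Order.TTheory GRing.Theory Num.Theory.
Import numFieldNormedType.Exports.

Local Open Scope classical_set_scope.
Local Open Scope ring_scope.
Local Open Scope complex_scope.

(* A complex Hilbert space is a complete normed module over R[i] together with
   a positive definite Hermitian form that induces its norm.  Forms of type
   {dot _ for Num.conj} are linear in their first argument, whereas <x|y> is
   linear in y. *)
Definition induces_norm (R : realType) (T : completeNormedModType R[i])
  (ip : {dot T for Num.conj}) : Prop := forall x : T, `|x| ^+ 2 = ip x x.

Definition braket (R : realType) (T : lmodType R[i]) (ip : {dot T for Num.conj})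
  (x y : T) : R[i] := ip y x.

Definition lspan (R : realType) (V : lmodType R[i]) (S : set V) : set V :=
  [set x | exists (n : nat) (c : 'I_n -> R[i]) (s : 'I_n -> V),
    (forall i, S (s i)) /\ x = \sum_(i < n) c i *: s i].

Definition total_set (R : realType) (T : completeNormedModType R[i])
  (S : set T) : Prop := closure (lspan S) = setT.

Section Operators.
Variables (R : realType) (T : completeNormedModType R[i]).
Variable ip : {dot T for Num.conj}.

Local Notation "<( x | y )>" := (braket ip x y).

Definition orthonormal_basis (B : set T) : Prop :=
  [/\ forall e, B e -> <(e | e)> = 1,
      forall e f, B e -> B f -> e <> f -> <(e | f)> = 0
    & total_set B].

Definition ketbra (psi : T) : T -> T := fun x => <(psi | x)> *: psi.

Definition linear_op (A : T -> T) : Prop :=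
  forall (c : R[i]) x y, A (c *: x + y) = c *: A x + A y.

(* On R[i], 0 <= z means that z is a nonnegative real number. *)
Definition positive_op (A : T -> T) : Prop :=
  linear_op A /\ forall x, 0 <= <(x | A x)>.

(* Trace of a positive operator, possibly +oo; its value does not depend on
   the orthonormal basis that is chosen. *)
Definition trace (A : T -> T) : \bar R :=
  \esum_(e in xget set0 orthonormal_basis) (complex.Re <(e | A e)>)%:E.

Definition is_adjoint (A B : T -> T) : Prop :=
  forall x y, <(A x | y)> = <(x | B y)>.

Definition adjoint (A : T -> T) : T -> T := xget 0 (is_adjoint A).

Definition is_sqrt (A S : T -> T) : Prop := positive_op S /\ S \o S = A.

Definition sqrt_op (A : T -> T) : T -> T := xget 0 (is_sqrt A).

Definition abs_op (A : T -> T) : T -> T := sqrt_op (adjoint A \o A).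

(* An everywhere defined linear operator is bounded iff it has an adjoint, and
   adjoint A \o A then has a positive square root, so the two existence clauses
   say exactly that A is bounded and that abs_op A is not a default value. *)
Definition trace_class (A : T -> T) : Prop :=
  [/\ linear_op A,
      exists B, is_adjoint A B,
      exists S, is_sqrt (adjoint A \o A) S
    & (trace (abs_op A) < +oo)%E].

Definition trace_norm (A : T -> T) : R := fine (trace (abs_op A)).

Definition fidelity (tau rho : T -> T) : R :=
  fine (trace (sqrt_op (sqrt_op tau \o rho \o sqrt_op tau))) ^+ 2.

(* Positivity of an n x n block operator, acting on the direct sum of n copies
   of T. *)
Definition block_positive (n : nat) (A : 'I_n -> 'I_n -> (T -> T)) : Prop :=
  forall x : 'I_n -> T, 0 <= \sum_i \sum_j <(x i | A i j (x j))>.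

(* Completely positive trace-preserving maps of the trace class.  Trace
   preservation is required on positive operators, which span the trace
   class. *)
Definition quantum_channel (Phi : (T -> T) -> (T -> T)) : Prop :=
  [/\ forall A, trace_class A -> trace_class (Phi A),
      forall (c : R[i]) A B, trace_class A -> trace_class B ->
        Phi (c *: A + B) = c *: Phi A + Phi B,
      forall n (A : 'I_n -> 'I_n -> (T -> T)),
        (forall i j, trace_class (A i j)) -> block_positive A ->
        block_positive (fun i j => Phi (A i j))
    & forall A, trace_class A -> positive_op A -> trace (Phi A) = trace A].

(* c is the coefficient in 8 (1 - sqrt F(rho, rho_g)) = c g^2 + o(g^2). *)
Definition is_weak_noise_qfi (rho : T -> T) (rho_ : R -> (T -> T)) (c : R)
  : Prop :=
  (fun g : R => 8 * (1 - Num.sqrt (fidelity rho (rho_ g)))) =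
  (fun g : R => c * g ^+ 2) +o_ ((0 : R)^') (fun g : R => g ^+ 2).

End Operators.

Lemma is_weak_noise_qfi_unique (R : realType) (T : completeNormedModType R[i])
  (ip : {dot T for Num.conj}) (rho : T -> T) (rho_ : R -> (T -> T)) (c c' : R) :
  is_weak_noise_qfi ip rho rho_ c -> is_weak_noise_qfi ip rho rho_ c' -> c = c'.
Proof.
move=> /eqaddoP hc /eqaddoP hc'.
apply/eqP; rewrite -subr_eq0; apply/negPn/negP => cc'.
have e0 : 0 < `|c - c'| / 4 by rewrite divr_gt0 // normr_gt0.
near (0 : R)^' => g.
have g0 : g != 0 by near: g; exact: nbhs_dnbhs_neq.
have g2 : 0 < `|g ^+ 2| by rewrite normr_gt0 expf_neq0.
have h1 : `|8 * (1 - Num.sqrt (fidelity ip rho (rho_ g))) - c * g ^+ 2|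
   <= `|c - c'| / 4 * `|g ^+ 2| by near: g; exact: hc.
have h2 : `|8 * (1 - Num.sqrt (fidelity ip rho (rho_ g))) - c' * g ^+ 2|
   <= `|c - c'| / 4 * `|g ^+ 2| by near: g; exact: hc'.
set s := 8 * _ in h1 h2.
have : `|(c - c') * g ^+ 2| <= `|c - c'| / 4 * `|g ^+ 2| + `|c - c'| / 4 * `|g ^+ 2|.
  rewrite (_ : _ * _ = (s - c' * g ^+ 2) - (s - c * g ^+ 2)); last by ring.
  by rewrite (le_trans (ler_normB _ _))// lerD.
rewrite normrM -mulrDl ler_pM2r // => h3.
have : 0 < `|c - c'| by rewrite normr_gt0.
lra.
Unshelve. all: by end_near.
Qed.

(* Possibly unbounded operators; values of app outside dom are meaningless. *)
Record operator (T : Type) := Operator { dom : set T; app :> T -> T }.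

Definition comp_op (T : Type) (A B : operator T) : operator T :=
  Operator [set x | dom B x /\ dom A (B x)] (A \o B).

Definition graph (T : Type) (A : operator T) : set (T * T) :=
  [set p | dom A p.1 /\ p.2 = A p.1].

(* Densely defined and symmetric; this includes all self-adjoint operators. *)
Definition hermitian_op (R : realType) (T : completeNormedModType R[i])
  (ip : {dot T for Num.conj}) (A : operator T) : Prop :=
  [/\ closure (dom A) = setT,
      forall (c : R[i]) x y, dom A x -> dom A y ->
        dom A (c *: x + y) /\ A (c *: x + y) = c *: A x + A y
    & forall x y, dom A x -> dom A y ->
        braket ip (A x) y = braket ip x (A y)].

Definition upd (K : nat) (X : Type) (x : 'I_K -> X) (j : 'I_K) (u : X)
  : 'I_K -> X := fun i => if i == j then u else x i.

(* T, with the map (x_1, ..., x_K) |-> x_1 (x) ... (x) x_K, is the Hilbert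
   space tensor power of H; this determines (T, tens) up to a unique unitary. *)
Definition is_tensor_power (R : realType) (K : nat)
  (H T : completeNormedModType R[i])
  (ipH : {dot H for Num.conj}) (ipT : {dot T for Num.conj})
  (tens : ('I_K -> H) -> T) : Prop :=
  [/\ forall x j (c : R[i]) (u w : H),
        tens (upd x j (c *: u + w)) =
        c *: tens (upd x j u) + tens (upd x j w),
      forall x y,
        braket ipT (tens x) (tens y) = \prod_(j < K) braket ipH (x j) (y j)
    & total_set (range tens)].

(* h is the operator 1 (x) ... (x) a (x) ... (x) 1, with a in position j: the
   closure of its restriction to the span of the elementary tensors whose j-th
   factor lies in the domain of a. *)
Definition acts_on_sensor (R : realType) (K : nat)
  (H T : completeNormedModType R[i]) (tens : ('I_K -> H) -> T)
  (j : 'I_K) (a : operator H) (h : operator T) : Prop :=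
  graph h = closure (lspan
    [set p : T * T | exists2 x : 'I_K -> H, dom a (x j) &
       p = (tens x, tens (upd x j (a (x j))))]).

(* rho_g = rho
     + g^2 \sum_ij v_ij (h_i rho h_j - (h_i h_j rho + rho h_i h_j) / 2) + Rem_g
   with || Rem_g ||_1 = o(g^2).  Since the h_i may be unbounded, the equation
   between operators is asserted on the common domain of the products h_i h_j
   (hence of the h_j), where its right-hand side makes sense for
   rho = |psi><psi| and psi in that domain. *)
Definition weak_noise_expansion (R : realType) (K : nat)
  (T : completeNormedModType R[i]) (ip : {dot T for Num.conj})
  (v : 'M[R]_K) (h : 'I_K -> operator T)
  (rho : T -> T) (rho_ : R -> (T -> T)) : Prop :=
  exists Rem : R -> (T -> T),
  [/\ \forall g \near (0 : R)^', trace_class ip (Rem g),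
      (fun g => trace_norm ip (Rem g)) =o_ ((0 : R)^') (fun g : R => g ^+ 2)
    & \forall g \near (0 : R)^', forall x,
        (forall j, dom (h j) x) ->
        (forall i j, dom (comp_op (h i) (h j)) x) ->
        rho_ g x = rho x
          + (g ^+ 2)%:C *: (\sum_(i < K) \sum_(j < K) (v i j)%:C *:
              (h i (rho (h j x))
               - 2^-1 *: (h i (h j (rho x)) + rho (h i (h j x)))))
          + Rem g x].

Definition psd_mx (R : realType) (K : nat) (v : 'M[R]_K) : Prop :=
  v^T = v /\ forall x : 'cV[R]_K, 0 <= (x^T *m v *m x) 0 0.

Definition generator_cov (R : realType) (K : nat)
  (T : completeNormedModType R[i]) (ip : {dot T for Num.conj})
  (h : 'I_K -> operator T) (psi : T) : 'M[R[i]]_K :=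
  \matrix_(i, j) (braket ip psi (h i (h j psi))
                  - braket ip psi (h i psi) * braket ip psi (h j psi)).

(* Main.v *)
Require Import Defs.
From mathcomp Require Import all_boot all_order all_algebra finmap.
From mathcomp Require Import all_classical all_reals all_analysis.
From mathcomp Require Import complex ring lra.
Import numFieldNormedType.Exports.
Import Order.TTheory GRing.Theory Num.Theory.
Local Open Scope classical_set_scope.
Local Open Scope ring_scope.
Local Open Scope complex_scope.

Set Implicit Arguments.
Unset Strict Implicit.
Unset Printing Implicit Defensive.

(** Since sqrt rho = rho for a pure state, sqrt rho rho_g sqrt rho = q rho with
   q = <psi|rho_g|psi>, so the fidelity is q.  Taking the expansion of rho_g at
   psi gives q = 1 - g^2 Tr(v H) + <psi|R_g|psi>, where the last term is at most
   ||R_g||_1 = o(g^2) in modulus; dividing imaginary parts by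
   g^2 shows that Tr(v H) is real, as q is.  The traces are computed with Parseval's identity, in an orthonormal
   basis that exists by Zorn's lemma and the projection theorem. *)

(** * Real and imaginary parts of complex numbers *)

Section ComplexParts.
Variable R : realType.

Lemma Re_sumE (I : Type) (r : seq I) (F : I -> R[i]) :
  (\sum_(i <- r) (complex.Re (F i))%:E = (complex.Re (\sum_(i <- r) F i)%R)%:E)%E.
Proof.
by apply/esym/(big_morph (fun z : R[i] => (complex.Re z)%:E)) => // -[a b] [c d].
Qed.

Lemma ReD (z w : R[i]) : complex.Re (z + w) = complex.Re z + complex.Re w.
Proof. by case: z w => a b []. Qed.

Lemma ReC_ge0 (z : R[i]) : 0 <= z -> (complex.Re z)%:C = z.
Proof. by move=> /ger0_real; exact: RRe_real. Qed.

Lemma ler_Re (z w : R[i]) : z <= w -> complex.Re z <= complex.Re w.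
Proof. by rewrite lecE => /andP[]. Qed.

(** Multiplication by [i] preserves the modulus and turns the imaginary part into a real part up to
    sign. *)
Lemma normc_ge_Im (z : R[i]) : `|complex.Im z|%:C <= `|z|.
Proof.
have := normc_ge_Re (z * 'i%C).
by rewrite ReiNIm normrN normrM [X in _ * X]normc_def /= expr0n expr1n add0r sqrtr1 mulr1.
Qed.

End ComplexParts.

(** * Linear spans *)

Section LinearSpan.
Variables (R : realType) (V : lmodType R[i]).

Lemma lspan_mem (B : set V) e : B e -> lspan B e.
Proof.
move=> Be; exists 1%N, (fun=> 1), (fun=> e); split=> //.
by rewrite big_ord1 scale1r.
Qed.

Lemma lspanZ (B : set V) c x : lspan B x -> lspan B (c *: x).
Proof.
move=> [n [k [t [tB ->]]]]; exists n, (fun i => c * k i), t; split=> //.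
by rewrite scaler_sumr; apply: eq_bigr => i _; rewrite scalerA.
Qed.

Lemma lspanD (B : set V) x y : lspan B x -> lspan B y -> lspan B (x + y).
Proof.
move=> [n [k [t [tB ->]]]] [m [l [u [uB ->]]]].
exists (n + m)%N, (fun i => match fintype.split i with inl a => k a | inr b => l b end),
  (fun i => match fintype.split i with inl a => t a | inr b => u b end); split.
  by move=> i; case: (fintype.split i).
rewrite big_split_ord /=; congr (_ + _); apply: eq_bigr => i _.
  by rewrite (unsplitK (inl _ i)).
by rewrite (unsplitK (inr _ i)).
Qed.

End LinearSpan.

(** * Inner product algebra, Pythagoras and the parallelogram law *)

Section InnerProduct.
Variables (R : realType) (T : completeNormedModType R[i]).
Variable ip : {dot T for Num.conj}.
Hypothesis normT : induces_norm ip.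

Local Notation "<( x | y )>" := (braket ip x y).

Lemma braketC x y : <(x | y)> = (<(y | x)>^*)%R.
Proof. by rewrite /braket hermC expr0 mul1r. Qed.

Lemma braketDr x y z : <(x | y + z)> = <(x | y)> + <(x | z)>.
Proof. exact: linearDl. Qed.

Lemma braketDl x y z : <(x + y | z)> = <(x | z)> + <(y | z)>.
Proof. exact: linearDr. Qed.

Lemma braketNr x y : <(x | - y)> = - <(x | y)>.
Proof. exact: linearNl. Qed.

Lemma braketNl x y : <(- x | y)> = - <(x | y)>.
Proof. exact: linearNr. Qed.

Lemma braketBr x y z : <(x | y - z)> = <(x | y)> - <(x | z)>.
Proof. exact: linearBl. Qed.

Lemma braketBl x y z : <(x - y | z)> = <(x | z)> - <(y | z)>.
Proof. exact: linearBr. Qed.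

Lemma braketZr c x y : <(x | c *: y)> = c * <(x | y)>.
Proof. exact: linearZl_LR. Qed.

Lemma braketZl c x y : <(c *: x | y)> = (c^*)%R * <(x | y)>.
Proof. exact: linearZr_LR. Qed.

Lemma braket0r x : <(x | 0)> = 0.
Proof. exact: linear0l. Qed.

Lemma braket_sumr x (I : Type) (r : seq I) (P : pred I) (F : I -> T) :
  <(x | \sum_(i <- r | P i) F i)> = \sum_(i <- r | P i) <(x | F i)>.
Proof. exact: linear_sumlz. Qed.

Lemma braket_norm x : <(x | x)> = `|x| ^+ 2.
Proof. by rewrite normT. Qed.

Lemma braket_self_eq0 x : <(x | x)> = 0 -> x = 0.
Proof. by move/eqP; rewrite braket_norm expf_eq0 /= normr_eq0 => /eqP. Qed.

Lemma norm_pythagoras (x y : T) : <(x | y)> = 0 ->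
  `|x + y| ^+ 2 = `|x| ^+ 2 + `|y| ^+ 2.
Proof.
move=> xy; rewrite -!braket_norm braketDr !braketDl xy.
by rewrite (braketC y x) xy rmorph0 addr0 add0r.
Qed.

Lemma parallelogram (x y : T) :
  `|x + y| ^+ 2 + `|x - y| ^+ 2 = 2 * `|x| ^+ 2 + 2 * `|y| ^+ 2.
Proof.
rewrite -!braket_norm !(braketDr, braketDl, braketNr, braketNl); ring.
Qed.

(** * Linear and positive operators, Cauchy-Schwarz *)

Lemma linear_opD A x y : linear_op A -> A (x + y) = A x + A y :> T.
Proof. by move=> lA; rewrite -{1}[x]scale1r lA scale1r. Qed.

Lemma linear_op0 A : linear_op A -> A 0 = 0 :> T.
Proof.
move=> lA; apply: (addrI (A 0)).
by rewrite addr0 -(linear_opD _ _ lA) addr0.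
Qed.

Lemma linear_opZ A c x : linear_op A -> A (c *: x) = c *: A x :> T.
Proof. by move=> lA; rewrite -{1}[_ *: x]addr0 lA linear_op0 ?addr0. Qed.

Lemma linear_opN A x : linear_op A -> A (- x) = - A x :> T.
Proof. by move=> lA; rewrite -scaleN1r (linear_opZ _ _ lA) scaleN1r. Qed.

Lemma linear_opB A x y : linear_op A -> A (x - y) = A x - A y :> T.
Proof. by move=> lA; rewrite linear_opD// linear_opN. Qed.

(* Polarization: <x + c y| S (x + c y)> is real for c = 1 and c = i. *)
Lemma positive_op_sym S x y : positive_op ip S -> <(S x | y)> = <(x | S y)>.
Proof.
move=> [lS pS].
have realP c : (c * <(x | S y)> + (c^*)%R * <(y | S x)>) \is Num.real.
  have := ger0_real (pS (x + c *: y)).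
  rewrite (linear_opD _ _ lS) (linear_opZ _ _ lS) braketDr !braketDl.
  rewrite !braketZl !braketZr => h.
  have -> : c * <(x | S y)> + (c^*)%R * <(y | S x)> =
    (<( x | S x )> + (c^*)%R * <( y | S x )> +
     (c * <( x | S y )> + (c^*)%R * (c * <( y | S y )>)))
    - <( x | S x )> - c * (c^*)%R * <( y | S y )> by ring.
  apply: rpredB; first apply: rpredB => //; first exact: ger0_real.
  by apply: ger0_real; rewrite mulr_ge0 // -normCK exprn_ge0.
rewrite braketC.
move: (<(x | S y)>) (<(y | S x)>) realP => [a b] [c d] realP.
(* The choice [c = i] equates the real parts of the two numbers, and [c = 1] makes their imaginary
   parts opposite. *)
have := realP 1; have := realP 'i%C; rewrite rmorph1 !mul1r.
rewrite -[('i%C)^*%R]/('i%C^*)%C -[Num.conj _]/((c +i* d)^*)%C /=.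
rewrite /GRing.mul/= /GRing.add /= !complex_real => /eqP h1 /eqP h2.
have {}h1 : 0 * b + 1 * a + (0 * d + -1 * c) = 0 by exact: h1.
congr Complex; lra.
Qed.

(** With [z = <x|Sy>] and [w = <y|Sy> > 0], positivity at [w x - z^* y] reads
    [w (<x|Sx> w - |z|^2) >= 0]. If [w = 0], the roles of [x] and [y] are exchanged; if both
    diagonal terms vanish, positivity at [x - z^* y] reads [- 2 |z|^2 >= 0]. *)
Lemma positive_op_CauchySchwarz S x y : positive_op ip S ->
  `|<(x | S y)>| ^+ 2 <= <(x | S x)> * <(y | S y)>.
Proof.
move=> pS; have [lS pS0] := pS.
wlog y0 : x y / 0 < <(y | S y)>.
  move=> H; have := pS0 y; rewrite le_eqVlt => /orP[/eqP y0|/H //].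
  have := pS0 x; rewrite le_eqVlt => /orP[/eqP x0|/(H y x)].
    rewrite -x0 mul0r.
    have := pS0 (x - (<(x | S y)>^*)%R *: y).
    rewrite (linear_opB _ _ lS) (linear_opZ _ _ lS) braketBr !braketBl.
    rewrite !braketZl !braketZr conjCK -x0 -y0.
    rewrite -(positive_op_sym y x pS) (braketC (S y)) normCK.
    set z := <(x | S y)>.
    rewrite (_ : _ - _ = - (2 * (z * (z^*)%R))); last by ring.
    by rewrite oppr_ge0 pmulr_rle0.
  rewrite -(positive_op_sym y x pS) (braketC (S y)) norm_conjC.
  by rewrite [in X in X -> _]mulrC.
have := pS0 (<(y | S y)> *: x - (<(x | S y)>^*)%R *: y).
rewrite (linear_opB _ _ lS) !(linear_opZ _ _ lS) braketBr !braketBl.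
rewrite !braketZl !braketZr conjCK.
rewrite -(positive_op_sym y x pS) (braketC (S y)).
have -> : (<(y | S y)>^*)%R = <(y | S y)> by apply: conj_Creal; exact: ger0_real.
set z := <(x | S y)>; set w := <(y | S y)> in y0 *.
rewrite (_ : _ - _ = w * (<(x | S x)> * w - z * (z^*)%R)); last by ring.
by rewrite pmulr_rge0 // subr_ge0 -normCK.
Qed.

Lemma positive_op_id : positive_op ip id.
Proof. by split=> // x; rewrite braket_norm exprn_ge0. Qed.

Lemma CauchySchwarz_norm x y : `|<(x | y)>| <= `|x| * `|y|.
Proof.
rewrite -(@ler_pXn2r _ 2) ?nnegrE ?mulr_ge0//.
have := positive_op_CauchySchwarz x y positive_op_id.
by rewrite /= !braket_norm exprMn.
Qed.

(** * Fourier sums over orthonormal families and Parseval's identity *)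

Lemma closure_normP (A : set T) x : closure A x <->
  forall e : R[i], 0 < e -> exists2 y, A y & `|x - y| < e.
Proof.
split=> [clx e e0|H B /nbhs_ballP[e e0 sB]].
  have [y [Ay]] := clx _ (nbhsx_ballx x e e0).
  by rewrite -ball_normE => xy; exists y.
have [y Ay xy] := H e e0; exists y; split=> //.
by apply: sB; rewrite -ball_normE.
Qed.

Definition orthonormal_set (B : set T) : Prop :=
  (forall e, B e -> <(e | e)> = 1) /\
  (forall e f, B e -> B f -> e <> f -> <(e | f)> = 0).

(** For a duplicate-free orthonormal list [s], this is the orthogonal projection of [x] onto the
    span of [s]. *)
Definition fourier_sum (s : seq T) (x : T) : T := \sum_(e <- s) <(e | x)> *: e.

Section FourierSum.
Variables (B : set T) (s : seq T).
Hypotheses (onB : orthonormal_set B) (sB : forall e, e \in s -> B e).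
Hypothesis us : uniq s.

Lemma braket_fourier_sum e x : e \in s -> <(e | fourier_sum s x)> = <(e | x)>.
Proof.
move=> es; rewrite braket_sumr (bigD1_seq e) //= braketZr (onB.1 _ (sB es)) mulr1.
rewrite big1_seq ?addr0 // => f /andP[/eqP fe fs].
by rewrite braketZr (onB.2 _ _ (sB es) (sB fs)) ?mulr0 // => ef; apply: fe.
Qed.

Lemma fourier_sum_orthogonal e x : e \in s -> <(x - fourier_sum s x | e)> = 0.
Proof.
by move=> es; rewrite braketC braketBr braket_fourier_sum // subrr rmorph0.
Qed.

Lemma norm_fourier_sum x : `|x| ^+ 2 =
  `|x - fourier_sum s x| ^+ 2 + \sum_(e <- s) `|<(e | x)>| ^+ 2.
Proof.
rewrite -{1}[x](subrK (fourier_sum s x)) norm_pythagoras; last first.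
  rewrite braket_sumr big1_seq // => e /= es.
  by rewrite braketZr fourier_sum_orthogonal ?mulr0.
congr (_ + _); rewrite -[LHS]braket_norm [in X in <(_ | X)>]/fourier_sum.
rewrite braket_sumr; apply: eq_big_seq => e es.
by rewrite braketZr (braketC _ e) braket_fourier_sum // normCK.
Qed.

(** The residual [x - fourier_sum s x] is orthogonal to the span of [s], hence to
    [fourier_sum s x - y]; Pythagoras then applies to their sum [x - y]. *)
Lemma fourier_sum_best_approx x y : lspan [set` s] y ->
  `|x - fourier_sum s x| ^+ 2 <= `|x - y| ^+ 2.
Proof.
move=> [n [c [t [ts ->]]]]; set y0 := \sum_(i < n) _.
rewrite -[X in _ <= `|X - _| ^+ 2](subrK (fourier_sum s x)) -[X in _ <= `|X| ^+ 2]addrA.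
rewrite [leRHS]norm_pythagoras ?lerDl ?exprn_ge0 //.
rewrite braketBr braket_sumr big1_seq => [|e /= es]; last first.
  by rewrite braketZr fourier_sum_orthogonal ?mulr0.
rewrite braket_sumr big1 ?subr0 // => i _.
by rewrite braketZr fourier_sum_orthogonal ?mulr0 //; exact: ts.
Qed.

End FourierSum.

(** The vectors in a linear combination may repeat; Fourier sums require a duplicate-free list. *)
Lemma lspan_finite (B : set T) y : lspan B y ->
  exists s : seq T, [/\ uniq s, forall e, e \in s -> B e & lspan [set` s] y].
Proof.
move=> [n [c [t [tB ->]]]]; exists (undup (map t (enum 'I_n))); split.
- exact: undup_uniq.
- by move=> e; rewrite mem_undup => /mapP[i _ ->].
- exists n, c, t; split=> // i /=.
  by rewrite mem_undup map_f // mem_enum.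
Qed.

(** Every finite partial sum is at most [|x|^2] by Bessel. Conversely, totality gives a finite
    combination near [x], and the projection onto the span of the vectors it involves is at least as
    close. *)
Lemma parseval (B : set T) x : orthonormal_basis ip B ->
  (\esum_(e in B) (complex.Re (`|<(e | x)>| ^+ 2))%:E =
   (complex.Re (`|x| ^+ 2))%:E)%E.
Proof.
move=> [B1 B0 Btot]; have onB : orthonormal_set B by [].
apply/eqP; rewrite eq_le; apply/andP; split.
  apply: ge_ereal_sup => _ [A [finA AB] <-].
  rewrite fsbig_finite // Re_sumE lee_fin; apply: ler_Re.
  rewrite [leRHS](norm_fourier_sum (B := B) (s := finmap.enum_fset (fset_set A))) //.
  - by rewrite lerDr exprn_ge0.
  - by move=> e; rewrite -[_ \in _]/(e \in fset_set A) in_fset_set // inE => /AB.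
  - exact: fset_uniq.
apply/lee_addgt0Pr => e e0.
have : closure (lspan B) x by rewrite Btot.
(* The radius [sqrt e] makes the squared residual at most [e]. *)
move=> /closure_normP /(_ (Num.sqrt e)%:C); rewrite ltcR sqrtr_gt0 => /(_ e0).
move=> [y By xy]; have [s [us sB sy]] := lspan_finite By.
have xs := fourier_sum_best_approx onB sB us x sy.
apply: (@le_trans _ _ (\sum_(f <- s) (complex.Re (`|<(f | x)>| ^+ 2)%R)%:E + e%:E)%E).
  rewrite Re_sumE -EFinD lee_fin (norm_fourier_sum onB sB us).
  rewrite -[leRHS]/(_ + complex.Re e%:C) -ReD.
  apply: ler_Re; rewrite [leLHS]addrC lerD2l (le_trans xs) //.
  rewrite -[in leRHS](sqr_sqrtr (ltW e0)) rmorphXn /= ler_pXn2r ?nnegrE //.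
    exact: ltW.
  by rewrite ler0c sqrtr_ge0.
rewrite leeD2r // esum_ge //; exists [set` s].
  by split; [exact: finite_seq|].
rewrite fsbig_finite; last exact: finite_seq.
rewrite [leRHS](perm_big s) //.
apply: uniq_perm => //; first exact: fset_uniq.
move=> f; rewrite -[LHS]/(f \in fset_set [set` s]) in_fset_set; last exact: finite_seq.
by apply/idP/idP; rewrite inE.
Qed.

(** * The projection theorem and the existence of an orthonormal basis *)

Lemma exists_orthogonal (L : set T) x :
  L 0 -> (forall c y w, L y -> L w -> L (c *: y + w)) -> ~ closure L x ->
  exists2 z, z != 0 & forall y, L y -> <(y | z)> = 0.
Proof.
move=> L0 LP clLx.
pose D := [set complex.Re (`|x - y| ^+ 2) | y in L].
pose d := inf D.
have D_ge0 : lbound D 0.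
  by move=> _ [y _ <-]; have := ler_Re (exprn_ge0 2 (normr_ge0 (x - y))).
have D0 : D !=set0 by exists (complex.Re (`|x - 0| ^+ 2)), 0.
have hD : has_inf D by split=> //; exists 0.
have dle y : L y -> d%:C <= `|x - y| ^+ 2.
  move=> Ly; rewrite -[leRHS]ReC_ge0 ?exprn_ge0 // lecR.
  by apply: ge_inf; [exact: hD.2|exists y].
(* The parallelogram law makes a minimizing sequence u of |x - y|, y in L, Cauchy. *)
have /choice[u uP] (n : nat) : exists y,
    L y /\ `|x - y| ^+ 2 <= (d + n.+1%:R^-1)%:C.
  have n0 : 0 < n.+1%:R^-1 :> R by rewrite invr_gt0 ltr0n.
  have [_ [y Ly <-] yd] := inf_adherent n0 hD.
  exists y; split=> //; rewrite -[leLHS]ReC_ge0 ?exprn_ge0 // lecR.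
  exact: ltW.
have ndist n m : `|u n - u m| ^+ 2 <= (2 * n.+1%:R^-1 + 2 * m.+1%:R^-1)%:C.
  have [[Ln un] [Lm um]] := (uP n, uP m).
  (* Half the sum of the two vectors is [x - mid], where [mid] is the midpoint of [u m] and [u n].
     Since [mid] lies in [L], its squared distance to [x] is at least [d]. *)
  have := parallelogram (x - u m) (x - u n).
  have -> : x - u m - (x - u n) = u n - u m by rewrite opprB addrC addrA subrK.
  have -> : x - u m + (x - u n) = 2 *: (x - (2^-1 *: u m + 2^-1 *: u n)).
    rewrite scalerBr scalerDr !scalerA divff ?pnatr_eq0 // !scale1r.
    by rewrite -[2]/(1 + 1) scalerDl scale1r opprD addrACA.
  set mid := 2^-1 *: u m + _; have Lmid : L mid.
    by apply: (LP) => //; rewrite -[_ *: _]addr0; apply: (LP).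
  rewrite normrZ exprMn => h.
  have -> : `|u n - u m| ^+ 2 =
      2 * `|x - u m| ^+ 2 + 2 * `|x - u n| ^+ 2 - `|2%:R| ^+ 2 * `|x - mid| ^+ 2.
    by rewrite -h; ring.
  have -> : (2 * n.+1%:R^-1 + 2 * m.+1%:R^-1)%:C =
     2 * (d + m.+1%:R^-1)%:C + 2 * (d + n.+1%:R^-1)%:C - `|2%:R| ^+ 2 * d%:C.
    by rewrite normr_nat !rmorphD !rmorphM /= rmorph_nat; ring.
  by rewrite lerB // ?lerD // ler_wpM2l ?exprn_ge0 //; exact: dle.
have ncauchy : cauchy (u @ \oo).
  apply: cauchy_exP => e e0.
  have eE : (complex.Re e)%:C = e by apply: ReC_ge0; exact: ltW.
  have r0 : 0 < complex.Re e by rewrite -ltcR eE.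
  (* Beyond [N], [ndist] is below four fifths of [e^2]. *)
  have e2 : 0 < complex.Re e ^+ 2 / 5 by rewrite divr_gt0 ?exprn_gt0.
  have [N _ NP] := near_infty_natSinv_lt (PosNum e2).
  exists (u N); exists N => // n /= Nn.
  rewrite -ball_normE /= -(@ltr_pXn2r _ 2) ?nnegrE ?normr_ge0 ?(ltW e0) //.
  apply: le_lt_trans (ndist _ _) _.
  rewrite -eE -rmorphXn /= ltcR.
  have /= := NP _ Nn; have /= := NP _ (leqnn N).
  move: (N.+1%:R^-1) (n.+1%:R^-1) (complex.Re e ^+ 2) (e2) => a b c; lra.
pose y : T := lim (u @ \oo).
have uy : u @ \oo --> y by exact: cauchy_cvg.
have /cvgrPdist_lt ucv := uy.
(* If [x = y], then [x] is a limit of points of [L], against the assumption. *)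
exists (x - y).
  apply/eqP => xy; apply: clLx; apply/closure_normP => e e0.
  have [n _ nP] := ucv _ e0; exists (u n); first exact: (uP n).1.
  by rewrite -[x](subrK y) xy add0r; apply: nP => /=.
move=> w Lw; have [->|w0] := eqVneq w 0; first by rewrite braketC braket0r rmorph0.
have W0 : 0 < `|w| by rewrite normr_gt0.
(* Moving [u n] by [(c / |w|^2) w] stays in [L] and lowers the squared distance to [x] by
   [|c|^2 / |w|^2]. As this distance exceeded [d] by at most [1 / (n + 1)], the drop is no
   larger. *)
have wun n : `|<(w | x - u n)>| ^+ 2 <= `|w| ^+ 2 * (n.+1%:R^-1)%:C.
  have [Ln un] := uP n; set c := <(w | x - u n)>.
  have := dle (`|w| ^- 2 * c *: w + u n) (LP _ _ _ Lw Ln).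
  have -> : x - (`|w| ^- 2 * c *: w + u n) = (x - u n) - `|w| ^- 2 * c *: w.
    by rewrite opprD addrA addrAC.
  rewrite -braket_norm !(braketBr _ (x - u n)) !(braketBl (x - u n)).
  rewrite !(braketZl, braketZr) !braket_norm (braketC (x - u n)) -/c => h.
  have W2 : `|w| ^+ 2 != 0 by rewrite expf_neq0 // gt_eqF.
  have cW : ((`|w| ^- 2)^*)%R = `|w| ^- 2.
    by apply: conj_Creal; rewrite realV realX // normr_real.
  rewrite -ler_pdivrMl ?exprn_gt0 // -(lerD2l d%:C) -rmorphD /=.
  rewrite (le_trans _ un) // -lerBrDr (le_trans h) // le_eqVlt; apply/orP; left.
  apply/eqP; rewrite rmorphM /= cW normCK; field.
  by rewrite normr_eq0.
apply/eqP/negPn/negP => c0.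
set c := `|<(w | x - y)>|.
have {}c0 : 0 < c by rewrite normr_gt0.
(* This [e] makes the bound [c <= 2 |w| e], obtained below by passing through [u n], contradict
   [c = 3 (|w| + 1) e]. *)
pose e := c / (3 * (`|w| + 1)).
have W1 : 0 < 3 * (`|w| + 1) by rewrite mulr_gt0 // addr_gt0.
have e0 : 0 < e by rewrite divr_gt0.
have eE : (complex.Re e)%:C = e by apply: ReC_ge0; exact: ltW.
have r0 : 0 < complex.Re e by rewrite -ltcR eE.
have e2 : 0 < complex.Re e ^+ 2 by rewrite exprn_gt0.
have [N _ NP] := near_infty_natSinv_lt (PosNum e2).
have [M _ MP] := ucv _ e0.
pose n := maxn N M.
have h1 : `|<(w | x - u n)>| <= `|w| * e.
  rewrite -(@ler_pXn2r _ 2) ?nnegrE ?normr_ge0 ?(mulr_ge0 (normr_ge0 w) (ltW e0)) //.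
  rewrite exprMn (le_trans (wun n)) // ler_wpM2l ?exprn_ge0 //.
  by rewrite -eE -rmorphXn /= lecR ltW //; apply: NP; exact: leq_maxl.
have h2 : `|<(w | u n - y)>| <= `|w| * e.
  rewrite (le_trans (CauchySchwarz_norm _ _)) // ler_wpM2l // distrC ltW //.
  by apply: MP; exact: leq_maxr.
have : c <= `|w| * e + `|w| * e.
  rewrite /c -[x](subrK (u n)) -addrA braketDr (le_trans (ler_normD _ _)) //.
  exact: lerD.
have -> : c = e * (3 * (`|w| + 1)) by rewrite /e divfK // gt_eqF.
rewrite -subr_ge0.
have -> : `|w| * e + `|w| * e - e * (3 * (`|w| + 1)) = - (`|w| * e + 3 * e) by ring.
have pos : 0 < `|w| * e + 3 * e by rewrite addr_gt0 // mulr_gt0.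
by rewrite oppr_ge0 => /(lt_le_trans pos); rewrite ltxx.
Qed.
(** Zorn's lemma gives a maximal orthonormal set. Were its span not dense, a unit vector orthogonal
    to it could be added. *)
Lemma orthonormal_basis_exists : exists B : set T, orthonormal_basis ip B.
Proof.
have [|B [[B1 B0] Bmax]] := @Zorn_bigcup T orthonormal_set.
  move=> F FP Ftot.
  split=> [e [X FX Xe]|e f [X FX Xe] [Y FY Yf]]; first exact: (FP _ FX).1.
  have [XY|YX] := Ftot _ _ FX FY; first exact: (FP _ FY).2 (XY _ Xe) Yf.
  exact: (FP _ FX).2 Xe (YX _ Yf).
exists B; split=> //; apply/seteqP; split=> // x _; apply: contrapT => clx.
have L0 : lspan B 0.
  by exists 0%N, (fun=> 0), (fun=> 0); split=> [[]//|]; rewrite big_ord0.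
have LP c y w : lspan B y -> lspan B w -> lspan B (c *: y + w).
  by move=> By Bw; apply: lspanD => //; exact: lspanZ.
have [z z0 zB] := exists_orthogonal L0 LP clx.
have Z0 : `|z| != 0 by rewrite normr_eq0.
pose f := `|z|^-1 *: z.
have f1 : <(f | f)> = 1.
  by rewrite braket_norm normrZ normfV normr_id mulVf // expr1n.
have fB e : B e -> <(e | f)> = 0.
  by move=> /lspan_mem /zB ez; rewrite braketZr ez mulr0.
apply: (Bmax (B `|` [set f])).
  split; first by move=> e; left.
  by move=> /(_ f (or_intror erefl)) /fB; rewrite f1 => /eqP; rewrite oner_eq0.
split=> [e [/B1 //|->//]|e g [Be|->] [Bg|->] eg]; first exact: B0.
- exact: fB.
- by rewrite braketC fB // rmorph0.
- by [].
Qed.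

(** * Trace and trace-norm bounds *)

Lemma xget_orthonormal_basis : orthonormal_basis ip (xget set0 (orthonormal_basis ip)).
(* Hence [trace] sums over a genuine basis and not over the default [set0]. *)
Proof. by apply: xgetPex; exact: orthonormal_basis_exists. Qed.

(** Summing [|<e|Sx>|^2 <= <e|Se> <x|Sx>] over the basis gives [|Sx|^2 <= tr S <x|Sx>] by Parseval.
    Since [<x|Sx> <= |x| |Sx|], one factor [|Sx|] cancels. *)
Lemma positive_op_norm_le_trace S x : positive_op ip S ->
  (trace ip S < +oo)%E -> `|S x| <= (fine (trace ip S))%:C * `|x|.
Proof.
move=> pS trS; have [_ S0] := pS.
have tr0 : (0 <= trace ip S)%E.
  by apply: esum_ge0 => e _; rewrite lee_fin (ler_Re (S0 e)).
have trE : (fine (trace ip S))%:E = trace ip S.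
  by rewrite fineK // ge0_fin_numE.
have t0 : 0 <= (fine (trace ip S))%:C by rewrite ler0c fine_ge0.
set t := fine _ in trE t0 *.
have h : `|S x| ^+ 2 <= t%:C * <(x | S x)>.
  rewrite -[leLHS]ReC_ge0 ?exprn_ge0 // -[<(x | S x)>]ReC_ge0 // -rmorphM lecR.
  rewrite -lee_fin -(parseval _ xget_orthonormal_basis); apply: ge_ereal_sup => _ [A [finA AB] <-].
  rewrite fsbig_finite // Re_sumE lee_fin.
  apply: (@le_trans _ _
    (complex.Re ((\sum_(e <- fset_set A) <(e | S e)>) * <(x | S x)>))).
    apply: ler_Re; rewrite mulr_suml; apply: ler_sum => e _.
    exact: positive_op_CauchySchwarz.
  rewrite -[<(x | S x)>]ReC_ge0 //.
  set z := \sum_(e <- _) _; have z0 : 0 <= z by exact: sumr_ge0.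
  rewrite -[z]ReC_ge0 // -rmorphM ler_wpM2r //; first exact: ler_Re (S0 x).
  rewrite -lee_fin trE -Re_sumE; apply: ereal_sup_ubound.
  by exists A => //; rewrite fsbig_finite.
have [->|Sx0] := eqVneq (S x) 0; first by rewrite normr0 mulr_ge0.
have {}Sx0 : 0 < `|S x| by rewrite normr_gt0.
rewrite -(ler_pM2r Sx0) -expr2 (le_trans h) // -mulrA ler_wpM2l //.
by rewrite (le_trans (real_ler_norm (ger0_real (S0 x)))) // CauchySchwarz_norm.
Qed.

Lemma adjointP A : trace_class ip A -> is_adjoint ip A (adjoint ip A).
Proof. by case=> _ exB _ _; exact: xgetPex. Qed.

Lemma abs_opP A : trace_class ip A -> is_sqrt ip (adjoint ip A \o A) (abs_op ip A).
Proof. by case=> _ _ exS _; exact: xgetPex. Qed.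

(** As [A^* A] is the square of [abs_op A], the vectors [A x] and [abs_op A x] have equal norms;
    Cauchy-Schwarz and the trace bound for the positive operator [abs_op A] finish. *)
Lemma trace_norm_ge A x : trace_class ip A ->
  `|<(x | A x)>| <= (trace_norm ip A)%:C * `|x| ^+ 2.
Proof.
move=> tA; have adjA := adjointP tA; have [pS SS] := abs_opP tA.
have [_ _ _ trA] := tA.
have AS : `|A x| = `|abs_op ip A x|.
  apply/eqP; rewrite -(@eqrXn2 _ 2) // -!braket_norm adjA.
  by rewrite (positive_op_sym x) // -[adjoint _ _ _]/((adjoint ip A \o A) x) -SS.
rewrite (le_trans (CauchySchwarz_norm _ _)) // AS expr2 mulrA mulrC.
by rewrite ler_wpM2r // positive_op_norm_le_trace.
Qed.

(** * Pure states: square root, trace, fidelity and image under a channel *)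

Section PureState.
Variable psi : T.
Hypothesis psi1 : `|psi| = 1.

Let braket_psi : <(psi | psi)> = 1.
Proof. by rewrite braket_norm psi1 expr1n. Qed.

Lemma linear_ketbra : linear_op (ketbra ip psi).
Proof. by move=> c x y; rewrite /ketbra braketDr braketZr scalerDl scalerA. Qed.

Lemma positive_ketbraZ (c : R) : 0 <= c ->
  positive_op ip (fun x => c%:C *: ketbra ip psi x).
Proof.
move=> c0; split=> [k x y|x].
  rewrite linear_ketbra scalerDr; congr (_ + _).
  by rewrite [LHS]scalerA [RHS]scalerA mulrC.
rewrite /ketbra !braketZr mulr_ge0 ?ler0c // (braketC x) -normCK.
by rewrite exprn_ge0.
Qed.

(** Uniqueness is what identifies the root chosen by [sqrt_op]. A positive root [S] kills every [x]
    orthogonal to [psi], because [|Sx|^2 = <x|S(Sx)> = 0]; it therefore acts only along [psi], by a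
    nonnegative scalar of square [c]. *)
Lemma is_sqrt_ketbraZ (c : R) S : 0 <= c ->
  is_sqrt ip (fun x => c%:C *: ketbra ip psi x) S <->
  S = (fun x => (Num.sqrt c)%:C *: ketbra ip psi x).
Proof.
move=> c0; split=> [[pS SS]|->]; last first.
  split; first by apply: positive_ketbraZ; rewrite sqrtr_ge0.
  apply/funext => x; rewrite /= /ketbra !braketZr braket_psi mulr1 !scalerA.
  by rewrite mulrA -rmorphM -expr2 sqr_sqrtr.
have [lS S0] := pS.
have S2 x : S (S x) = c%:C *: (<(psi | x)> *: psi) by have /(congr1 (@^~ x)) := SS.
have Sker x : <(psi | x)> = 0 -> S x = 0.
  move=> x0; apply: braket_self_eq0.
  by rewrite positive_op_sym // S2 x0 scale0r scaler0 braket0r.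
(* [w] is the part of [S psi] orthogonal to [psi]. It vanishes because [<w|S psi> = <S w|psi>] and
   [S w = 0]. *)
pose l := <(psi | S psi)>; pose w := S psi - l *: psi.
have w0 : w = 0.
  have psiw : <(psi | w)> = 0 by rewrite braketBr braketZr braket_psi mulr1 subrr.
  apply: braket_self_eq0; rewrite {2}/w.
  rewrite braketBr braketZr -positive_op_sym // Sker // braketC braket0r.
  by rewrite rmorph0 braketC psiw rmorph0 mulr0 subr0.
have Spsi : S psi = l *: psi by apply/eqP; rewrite -subr_eq0 -/w w0.
have lE : (complex.Re l)%:C = l by exact: ReC_ge0 (S0 psi).
have l0 : 0 <= complex.Re l by rewrite -ler0c lE; exact: S0.
have l2 : complex.Re l ^+ 2 = c.
  apply: complexI; rewrite rmorphXn /= lE.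
  have := congr1 (braket ip psi) (S2 psi).
  by rewrite Spsi (linear_opZ _ _ lS) Spsi !braketZr braket_psi !mulr1 -expr2.
apply/funext => x.
rewrite -{1}[x](subrK (<(psi | x)> *: psi)) linear_opD // Sker; last first.
  by rewrite braketBr braketZr braket_psi mulr1 subrr.
rewrite add0r linear_opZ // Spsi -l2 sqrtr_sqr ger0_norm // lE /ketbra.
by rewrite !scalerA mulrC.
Qed.

Lemma sqrt_op_ketbraZ (c : R) : 0 <= c ->
  sqrt_op ip (fun x => c%:C *: ketbra ip psi x) =
  (fun x => (Num.sqrt c)%:C *: ketbra ip psi x).
Proof.
move=> c0; apply/(is_sqrt_ketbraZ _ c0); apply: xgetPex.
by eexists; apply/(is_sqrt_ketbraZ _ c0).
Qed.

Lemma ketbraZ1 : ketbra ip psi = (fun x => 1%:C *: ketbra ip psi x).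
Proof. by apply/funext => x; rewrite scale1r. Qed.

Lemma sqrt_op_ketbra : sqrt_op ip (ketbra ip psi) = ketbra ip psi.
Proof. by rewrite {1}ketbraZ1 sqrt_op_ketbraZ // sqrtr1 -ketbraZ1. Qed.

(** The diagonal entry at [e] is [|<e|sqrt c psi>|^2], so this is Parseval's identity for
    [sqrt c psi]. *)
Lemma trace_ketbraZ (c : R) : 0 <= c ->
  trace ip (fun x => c%:C *: ketbra ip psi x) = c%:E.
Proof.
move=> c0; rewrite /trace.
have := parseval ((Num.sqrt c)%:C *: psi) xget_orthonormal_basis.
rewrite normrZ psi1 mulr1 ger0_norm ?ler0c ?sqrtr_ge0 //.
rewrite -rmorphXn sqr_sqrtr // => <-.
apply: eq_esum => e _; congr (_%:E); congr (complex.Re _).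
rewrite /ketbra !braketZr normrM exprMn; congr (_ * _).
  by rewrite ger0_norm ?ler0c ?sqrtr_ge0 // -rmorphXn sqr_sqrtr.
by rewrite (braketC psi) mulrC -normCK.
Qed.

Lemma fidelity_ketbra A : positive_op ip A ->
  fidelity ip (ketbra ip psi) A = complex.Re <(psi | A psi)>.
Proof.
move=> [lA A0]; rewrite /fidelity sqrt_op_ketbra.
set q := complex.Re _; have qE : q%:C = <(psi | A psi)> by exact: ReC_ge0.
have q0 : 0 <= q by rewrite -ler0c qE.
have -> : ketbra ip psi \o A \o ketbra ip psi = (fun x => q%:C *: ketbra ip psi x).
  apply/funext => x.
  by rewrite /= /ketbra (linear_opZ _ _ lA) braketZr qE scalerA mulrC.
by rewrite sqrt_op_ketbraZ // trace_ketbraZ ?sqrtr_ge0 //= sqr_sqrtr.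
Qed.

Lemma is_adjoint_ketbra : is_adjoint ip (ketbra ip psi) (ketbra ip psi).
Proof.
by move=> x y; rewrite /ketbra braketZl braketZr (braketC x) mulrC.
Qed.

(** Adjoints are unique: the values of two candidates at [y] differ by a vector orthogonal to
    everything, itself included. *)
Lemma adjoint_ketbra : adjoint ip (ketbra ip psi) = ketbra ip psi.
Proof.
have adj : is_adjoint ip (ketbra ip psi) (adjoint ip (ketbra ip psi)).
  by apply: xgetPex; exists (ketbra ip psi); exact: is_adjoint_ketbra.
apply/funext => y; apply/eqP; rewrite -subr_eq0; apply/eqP.
by apply: braket_self_eq0; rewrite braketBr -adj is_adjoint_ketbra subrr.
Qed.

Lemma trace_class_ketbra : trace_class ip (ketbra ip psi).
Proof.
have kk : ketbra ip psi \o ketbra ip psi = ketbra ip psi.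
  by apply/funext => x; rewrite /= /ketbra braketZr braket_psi mulr1.
split; first exact: linear_ketbra.
- by exists (ketbra ip psi); exact: is_adjoint_ketbra.
- exists (ketbra ip psi); rewrite adjoint_ketbra; split=> //.
  by rewrite ketbraZ1; apply: positive_ketbraZ.
- rewrite /abs_op adjoint_ketbra kk sqrt_op_ketbra ketbraZ1 trace_ketbraZ //.
  exact: ltry.
Qed.

(** Complete positivity with a single block is positivity; linearity comes from the image being
    trace class. *)
Lemma channel_ketbra_positive (Phi : (T -> T) -> (T -> T)) :
  quantum_channel ip Phi -> positive_op ip (Phi (ketbra ip psi)).
Proof.
case=> Ptc _ Pcp _; split; first by have [] := Ptc _ trace_class_ketbra.
have [_ kpos] : positive_op ip (ketbra ip psi).
  by rewrite ketbraZ1; apply: positive_ketbraZ.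
move=> x.
have := Pcp 1%N (fun _ _ => ketbra ip psi) (fun _ _ => trace_class_ketbra).
move=> /(_ _ (fun=> x)); rewrite !big_ord1; apply=> y.
by rewrite !big_ord1.
Qed.

End PureState.
End InnerProduct.

(** * From the channel expansion to the Fisher information *)

Lemma acts_on_sensorZ (R : realType) (K : nat)
  (H T : completeNormedModType R[i]) (tens : ('I_K -> H) -> T) (j : 'I_K)
  (a : operator H) (h : operator T) (c : R[i]) (x : T) :
  acts_on_sensor tens j a h -> dom h x -> h (c *: x) = c *: h x.
Proof.
move=> hP hx; suff : graph h (c *: (x, h x)) by case.
have : graph h (x, h x) by [].
(* The graph is the closure of a linear span; as scaling is continuous, it is stable under
   scaling. *)
rewrite hP => clx B /(@scaler_continuous _ (T * T)%type c (x, h x)) /clx.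
by move=> [p [Lp Bp]]; exists (c *: p); split=> //; exact: lspanZ.
Qed.

(* 8 (1 - sqrt q) = 4 (1 - q) + 4 (1 - sqrt q)^2, where the last square is at
   most (1 - q)^2 = O(g^4). *)
Lemma sqrt_expansion (R : realType) (t : R) (q r : R -> R) :
  (\forall g \near (0 : R)^', 0 <= q g /\ q g = 1 - t * g ^+ 2 + r g) ->
  r =o_ ((0 : R)^') (fun g : R => g ^+ 2) ->
  (fun g => 8 * (1 - Num.sqrt (q g))) =
  (fun g : R => 4 * t * g ^+ 2) +o_ ((0 : R)^') (fun g : R => g ^+ 2).
Proof.
move=> qE /eqoP ro; apply/eqaddoP => e e0.
have t1 : 0 < `|t| + 1 by rewrite ltr_wpDl.
(* Once [g^2 <= d], the bound [u^2 <= (|t| + 1)^2 g^4] becomes [u^2 <= (e / 8) g^2]. With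
   [|r g| <= (e / 8) g^2], the error [4 (1 - s)^2 + 4 |r g|] is at most [e g^2]. *)
pose d := e / (8 * (`|t| + 1) ^+ 2).
have d0 : 0 < d by rewrite divr_gt0 // mulr_gt0 // exprn_gt0.
have e8 : 0 < e / 8 by rewrite divr_gt0.
near=> g.
have [q0 qg] : 0 <= q g /\ q g = 1 - t * g ^+ 2 + r g by near: g.
have r1 : `|r g| <= 1 * `|g ^+ 2| by near: g; exact: ro.
have r2 : `|r g| <= e / 8 * `|g ^+ 2| by near: g; exact: ro.
have gd : g ^+ 2 <= d.
  have : `|g| < Num.sqrt d.
    by near: g; apply: dnbhs0_lt; rewrite sqrtr_gt0.
  move=> /ltW gd; rewrite -(sqr_sqrtr (ltW d0)).
  by rewrite -[g ^+ 2]ger0_norm ?sqr_ge0 // normrX ler_pXn2r ?nnegrE ?sqrtr_ge0.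
have gn : `|g ^+ 2| = g ^+ 2 by rewrite ger0_norm ?sqr_ge0.
rewrite /= gn in r1 r2 *.
have g0 : 0 <= g ^+ 2 by rewrite sqr_ge0.
set G := g ^+ 2 in g0 gn gd r1 r2 qg *.
set s := Num.sqrt (q g); have s0 : 0 <= s by rewrite sqrtr_ge0.
have s2 : s ^+ 2 = q g by rewrite sqr_sqrtr.
pose u := 1 - q g.
have uG : `|u| <= (`|t| + 1) * G.
  rewrite /u qg (_ : 1 - _ = t * G - r g); last by ring.
  by rewrite (le_trans (ler_normB _ _)) // normrM gn mulrDl lerD.
have u2 : u ^+ 2 <= e / 8 * G.
  have h : `|u| ^+ 2 <= ((`|t| + 1) * G) ^+ 2.
    by rewrite ler_pXn2r ?nnegrE ?(mulr_ge0 (ltW t1)).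
  rewrite -real_normK ?num_real // (le_trans h) // exprMn expr2 mulrA.
  rewrite ler_wpM2r //; apply: (@le_trans _ _ ((`|t| + 1) ^+ 2 * d)).
    by rewrite ler_wpM2l // exprn_ge0 // ltW.
  rewrite /d le_eqVlt; apply/orP; left; apply/eqP; field.
  by rewrite gt_eqF.
(* Here [u = (1 - s) (1 + s)] with [1 + s >= 1]. *)
have s1 : 0 <= (1 - s) ^+ 2 <= u ^+ 2.
  rewrite sqr_ge0 /= /u -s2 (_ : 1 - s ^+ 2 = (1 - s) * (1 + s)); last by ring.
  by rewrite exprMn ler_peMr ?sqr_ge0 // expr_ge1 //; lra.
rewrite -[X in `|X|]/(8 * (1 - s) - 4 * t * G).
have -> : 8 * (1 - s) - 4 * t * G = 4 * (1 - s) ^+ 2 - 4 * r g.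
  have : r g = s ^+ 2 - 1 + t * G by rewrite s2 qg; ring.
  by move=> ->; ring.
move: s1 => /andP[s1 s1u]; rewrite (le_trans (ler_normB _ _)) //.
rewrite (ger0_norm (mulr_ge0 (ler0n R 4) s1)) normrM normr_nat; lra.
Unshelve. all: by end_near.
Qed.

Theorem mainTheorem2 (R : realType) (K : nat)
  (H T : completeNormedModType R[i])
  (ipH : {dot H for Num.conj}) (ipT : {dot T for Num.conj})
  (normH : induces_norm ipH) (normT : induces_norm ipT)
  (tens : ('I_K -> H) -> T) (tensP : is_tensor_power ipH ipT tens)
  (a : 'I_K -> operator H) (aP : forall j, hermitian_op ipH (a j))
  (h : 'I_K -> operator T) (hP : forall j, acts_on_sensor tens j (a j) (h j))
  (psi : T) (psi1 : `|psi| = 1)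
  (psi_dom : forall j, dom (h j) psi)
  (psi_dom2 : forall i j, dom (comp_op (h i) (h j)) psi)
  (v : 'M[R]_K) (vP : psd_mx v)
  (Phi : 'M[R]_K -> (T -> T) -> (T -> T))
  (PhiP : forall g : R, quantum_channel ipT (Phi (g ^+ 2 *: v)))
  (expansion : weak_noise_expansion ipT v h (ketbra ipT psi)
     (fun g => Phi (g ^+ 2 *: v) (ketbra ipT psi))) :
  exists2 FQ : R,
    is_weak_noise_qfi ipT (ketbra ipT psi)
      (fun g => Phi (g ^+ 2 *: v) (ketbra ipT psi)) FQ
    & FQ%:C = 4 * \tr (map_mx (real_complex R) v *m generator_cov ipT h psi).
Proof.
have [Rem [tcRem oRem expn]] := expansion.
set t := \tr _; pose rho_ g := Phi (g ^+ 2 *: v) (ketbra ipT psi).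
pose r g := braket ipT psi (Rem g psi).
have posrho g : positive_op ipT (rho_ g) by exact: channel_ketbra_positive.
have psipsi : braket ipT psi psi = 1 by rewrite braket_norm // psi1 expr1n.
(* Symmetry of [v] reconciles the index order of the matrix product with that of the expansion. *)
have tE : t = - \sum_(i < K) \sum_(j < K) (v i j)%:C *
    (braket ipT psi (h j psi) * braket ipT psi (h i psi)
     - braket ipT psi (h i (h j psi))).
  rewrite /t /mxtrace exchange_big -sumrN; apply: eq_bigr => i _.
  rewrite mxE -sumrN; apply: eq_bigr => j _.
  rewrite !mxE -{1}vP.1 mxE -[RHS]mulrN opprB.
  by congr (_ * (_ - _)); rewrite mulrC.
have qE : \forall g \near (0 : R)^',
    braket ipT psi (rho_ g psi) = 1 - t * (g ^+ 2)%:C + r g.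
  apply: filterS expn => g /(_ psi psi_dom psi_dom2).
  rewrite -/(rho_ g) => ->; rewrite !braketDr [X in _ + X + _]braketZr -/(r g).
  congr (_ + _ + _); first by rewrite /ketbra braketZr psipsi mulr1.
  rewrite tE mulNr opprK mulrC; congr (_ * _); rewrite braket_sumr.
  apply: eq_bigr => i _; rewrite braket_sumr; apply: eq_bigr => j _.
  rewrite braketZr braketBr braketZr braketDr; congr (_ * _).
  have ketpsi : ketbra ipT psi psi = psi by rewrite /ketbra psipsi scale1r.
  (* Homogeneity of [h i] extracts [<psi|h j psi>] from [h i (rho (h j psi))]; paired with [psi],
     both anticommutator terms equal [<psi|h i (h j psi)>], which absorbs the factor one half. *)
  rewrite ketpsi /ketbra (acts_on_sensorZ _ (hP i)) // !braketZr psipsi.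
  by congr (_ - _); field.
have rle : \forall g \near (0 : R)^', `|r g| <= (trace_norm ipT (Rem g))%:C.
  apply: filterS tcRem => g tcg.
  by have := trace_norm_ge normT psi tcg; rewrite psi1 expr1n mulr1.
have qIm g : complex.Im (braket ipT psi (rho_ g psi)) = 0.
  by apply: ger0_Im; exact: (posrho g).2.
have tR : complex.Im t = 0.
  apply/eqP/negPn/negP => Imt0.
  (* Since [q] is real, [Im (r g) = Im t * g^2]; a remainder bound with half of [|Im t|] contradicts
     this at any small nonzero [g]. *)
  have e0 : 0 < `|complex.Im t| / 2 by rewrite divr_gt0 // normr_gt0.
  have /eqoP/(_ _ e0) tne := oRem.
  near (0 : R)^' => g.
  have gn0 : g != 0 by near: g; exact: nbhs_dnbhs_neq.
  have g0 : 0 < g ^+ 2 by rewrite exprn_even_gt0.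
  have h1 : braket ipT psi (rho_ g psi) = 1 - t * (g ^+ 2)%:C + r g.
    by near: g.
  have h2 : `|r g| <= (trace_norm ipT (Rem g))%:C by near: g.
  have h3 : `|trace_norm ipT (Rem g)| <= `|complex.Im t| / 2 * `|g ^+ 2|.
    by near: g.
  have h4 : complex.Im (r g) = complex.Im t * g ^+ 2.
    have := qIm g; rewrite h1; case: (t) (r g) => [t1 t2] [r1 r2].
    by rewrite /= ; lra.
  have h5 : `|complex.Im (r g)| <= `|complex.Im t| / 2 * g ^+ 2.
    rewrite -[X in _ * X]ger0_norm ?sqr_ge0 //.
    rewrite (le_trans _ h3) // (le_trans _ (ler_norm _)) // -lecR.
    exact: le_trans (normc_ge_Im _) h2.
  move: h5; rewrite h4 normrM [X in _ * X <= _]ger0_norm ?sqr_ge0 // ler_pM2r //.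
  have : 0 < `|complex.Im t| by rewrite normr_gt0.
  lra.
pose t' := complex.Re t.
have t'E : t'%:C = t by rewrite [RHS]complexE tR rmorph0 mulr0 addr0.
exists (4 * t'); last by rewrite -t'E rmorphM rmorph_nat.
rewrite /is_weak_noise_qfi.
have -> : (fun g => 8 * (1 - Num.sqrt (fidelity ipT (ketbra ipT psi) (rho_ g)))) =
  (fun g => 8 * (1 - Num.sqrt (complex.Re (braket ipT psi (rho_ g psi))))).
  by apply/funext => g; rewrite fidelity_ketbra.
apply: (@sqrt_expansion _ _ _ (fun g => complex.Re (r g))).
  apply: filterS qE => g qg; split; first by have [_ /(_ psi)] := posrho g; move/ler_Re.
  by rewrite qg -t'E !ReD -rmorphM.
(* The real part of [r g] inherits the [o(g^2)] bound of the trace norm. *)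
apply/eqoP => e e0; have /eqoP/(_ _ e0) tne := oRem.
apply: filterS2 rle tne => g rg; apply: le_trans.
rewrite (le_trans _ (ler_norm _)) // -lecR.
exact: le_trans (normc_ge_Re _) rg.
Unshelve. all: by end_near.
Qed.
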